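(* Let $\mathscr T=(V,\mathcal E)$ be a rootless directed tree with finite branching index, non-empty set $V_\prec$ of branching vertices, and generalized root $\omega$. Let $S_\lambda\in B(l^2(V))$ be a left-invertible weighted shift on $\mathscr T$. Then there exist a Hilbert space $\mathscr H$ of vector-valued holomorphic functions in $z$ defined on a disc in $\mathbb C$, and a Hilbert space $\mathcal H$ of scalar-valued holomorphic functions in $t$ defined on a disc in $\mathbb C$, such that $S_\lambda$ is unitarily equivalent to $$\begin{bmatrix}\mathscr M_z & f\otimes g\\ 0& M_t^*\end{bmatrix}\quad\text{on }\mathscr H\oplus\mathcal H,$$ where $\mathscr M_z$ is the operator of multiplication by $z$ on $\mathscr H$, $f\otimes g$ is a rank one operator with $f\in\ker\mathscr M_z^*\setminus\{0\}$ and $g\in\ker M_t^*\setminus\{0\}$, and $M_t$ is the operator of multiplication by the co-ordinate function $t$ on $\mathcal H$.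
   Context: Directed trees. A directed graph is a pair $\mathscr T=(V,\mathcal E)$ with $V$ non-empty and $\mathcal E\subseteq V\times V\setminus\{(v,v):v\in V\}$. A circuit is a finite sequence of distinct vertices $v_1,\dots,v_n$, $n\ge2$, with $(v_i,v_{i+1})\in\mathcal E$ for $1\le i\le n-1$ and $(v_n,v_1)\in\mathcal E$. The graph is connected if any two distinct vertices are joined by a finite sequence of vertices in which, for consecutive vertices $a,b$, $(a,b)\in\mathcal E$ or $(b,a)\in\mathcal E$. A root is a vertex $v$ such that $(u,v)\in\mathcal E$ for no $u$. A directed tree is a connected directed graph without circuits in which every non-root vertex $v$ has a unique $u$ (the parent $\mathsf{par}(v)$) with $(u,v)\in\mathcal E$. It is rootless if it has no root. For $W\subseteq V$, $\mathsf{Chi}(W)=\bigcup_{u\in W}\{v:(u,v)\in\mathcal E\}$, $\mathsf{Chi}^{\langle0\rangle}(W)=W$, $\mathsf{Chi}^{\langle n\rangle}(W)=\mathsf{Chi}(\mathsf{Chi}^{\langle n-1\rangle}(W))$, and $\mathsf{Chi}(v)=\mathsf{Chi}(\{v\})$; $\mathsf{par}^{\langle n\rangle}$ is the $n$-fold iterate of $\mathsf{par}$. All directed trees are assumed countably infinite and leafless (every vertex has at least one child). Finite branching index (rootless case). Let $V_\prec=\{u\in V:\mathrm{card}(\mathsf{Chi}(u))\ge2\}$. A rootless directed tree has finite branching index if there exists a smallest non-negative integer $m_{\mathscr T}$ such that $\mathsf{Chi}^{\langle k\rangle}(V_\prec)\cap V_\prec=\emptyset$ for every integer $k\ge m_{\mathscr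 T}$. If in addition $V_\prec\neq\emptyset$, there is a unique $\omega\in V_\prec$ with $\mathrm{card}(\mathsf{Chi}(\mathsf{par}^{\langle k\rangle}(\omega)))=1$ for all integers $k\ge1$; it is called the generalized root. Weighted shifts. On $l^2(V)$, given positive weights $\{\lambda_v\}_{v\in V}$, the weighted shift on the rootless tree $\mathscr T$ is $(S_\lambda f)(v)=\lambda_vf(\mathsf{par}(v))$, $v\in V$, assumed bounded. $S_\lambda$ is left-invertible if it has a bounded left inverse. For $x\in\mathcal K_1$, $y\in\mathcal K_2$, $x\otimes y:\mathcal K_2\to\mathcal K_1$ is the rank one operator $h\mapsto\langle h,y\rangle x$. *)

(* Defs.v *)
From HB Require Import structures.
From mathcomp Require Import all_boot all_order all_algebra sesquilinear complex.
From mathcomp Require Import all_classical all_reals all_analysis.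
From mathcomp Require Import ring lra.

Set Implicit Arguments.
Unset Strict Implicit.
Unset Printing Implicit Defensive.

Import Order.TTheory GRing.Theory Num.Theory.
Import numFieldNormedType.Exports.

Local Open Scope classical_set_scope.
Local Open Scope complex_scope.
Local Open Scope card_scope.
Local Open Scope ring_scope.

Section DirectedTrees.
Variable V : countType.
Implicit Types (e : rel V) (u v : V) (W : set V).

Definition circuit e (s : seq V) := [&& (2 <= size s)%N, uniq s & cycle e s].

Definition connected_graph e := forall u v, u != v ->
  exists2 p : seq V, path [rel a b | e a b || e b a] u p & last u p = v.

Definition root_vertex e v := forall u, ~~ e u v.

Definition directed_tree e :=
  [/\ irreflexive e,
      connected_graph e,
      forall s, ~~ circuit e s &
      forall v, ~ root_vertex e v -> exists! u, e u v].

Definition rootless e := forall v, ~ root_vertex e v.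

Definition leafless e := forall u, exists v, e u v.

(* The default value v is only taken at a root. *)
Definition par e v : V := xget v [set u | e u v].

Definition Chi e W : set V := \bigcup_(u in W) [set v | e u v].

Definition branching_vertices e : set V := [set u | `I_2 #<= Chi e [set u]].

Definition branching_bound e (m : nat) := forall k, (m <= k)%N ->
  iter k (Chi e) (branching_vertices e) `&` branching_vertices e = set0.

Definition finite_branching_index e :=
  exists2 m, branching_bound e m & forall m', branching_bound e m' -> (m <= m')%N.

Definition generalized_root e (omega : V) :=
  branching_vertices e omega /\
  forall k, (1 <= k)%N -> Chi e [set iter k (par e) omega] #= `I_1.

End DirectedTrees.

(* In {dot V for Num.conj} forms are linear in the first variable and
   conjugate-linear in the second.  Norms are valued in R[i]. *)
HB.mixin Record NormedModule_isPreHilbert (R : realType) V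
    & NormedModule R[i] V := {
  inner : {dot V for Num.conj};
  inner_norm : forall x : V, inner x x = `|x| ^+ 2
}.

#[short(type="preHilbertType")]
HB.structure Definition PreHilbert (R : realType) :=
  {V of NormedModule R[i] V & NormedModule_isPreHilbert R V}.

#[short(type="hilbertType")]
HB.structure Definition Hilbert (R : realType) :=
  {V of PreHilbert R V & Complete V}.

Section DotNorm.
Variables (C : numClosedFieldType) (V : lmodType C) (form : {dot V for Num.conj}).

Definition dot_norm (x : V) : C := sqrtC (form x x).

Lemma dot_normK x : dot_norm x ^+ 2 = form x x.
Proof. exact: sqrtCK. Qed.

Lemma dot_norm_ge0 x : 0 <= dot_norm x.
Proof. exact: sqrt_dnorm_ge0. Qed.

Lemma dot_norm_eq0 x : dot_norm x = 0 -> x = 0.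
Proof. by move/eqP; rewrite sqrt_dnorm_eq0 => /eqP. Qed.

Lemma dot_normZ a x : dot_norm (a *: x) = `|a| * dot_norm x.
Proof.
by rewrite /dot_norm dnormZ sqrtCM ?nnegrE ?exprn_ge0 ?dnorm_ge0// sqrCK.
Qed.

Lemma dot_cauchy_schwarz x y : `|form x y| <= dot_norm x * dot_norm y.
Proof.
rewrite -(@ler_pXn2r _ 2) ?nnegrE ?mulr_ge0 ?dot_norm_ge0//.
rewrite exprMn !dot_normK.
have [->|y0] := eqVneq y 0.
  by rewrite linear0r normr0 linear0r expr0n mulr0.
have yy0 : 0 < form y y by rewrite dnorm_gt0.
pose a := form x y / form y y.
have ou : form (x - a *: y) y = 0.
  by rewrite linearBl/= linearZl_LR divfK ?subrr// gt_eqF.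
have xE : x = (x - a *: y) + a *: y by rewrite subrK.
have -> : form x x = form (x - a *: y) (x - a *: y) + `|a| ^+ 2 * form y y.
  rewrite [in LHS]xE dnormD dnormZ linearZr_LR/= ou mulr0 conjC0.
  by rewrite !addr0.
rewrite mulrDl -mulrA normrM normfV (gtr0_norm yy0) exprMn exprVn.
rewrite -expr2 divfK ?expf_neq0 ?gt_eqF// lerDr mulr_ge0 ?dnorm_ge0//.
Qed.

Lemma dot_normD x y : dot_norm (x + y) <= dot_norm x + dot_norm y.
Proof.
rewrite -(@ler_pXn2r _ 2) ?nnegrE ?addr_ge0 ?dot_norm_ge0//.
rewrite dot_normK dnormD sqrrD !dot_normK addrAC lerD2r lerD2l.
have h z : z + z^* <= `|z| *+ 2 :> C.
  have -> : z + z^* = 'Re z *+ 2 by rewrite ReE -mulr_natr divfK ?pnatr_eq0.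
  by rewrite lerMn2r leif_Re_Creal orbT.
by apply: (le_trans (h _)); rewrite lerMn2r dot_cauchy_schwarz orbT.
Qed.

End DotNorm.

HB.factory Record Lmodule_isPreHilbert (R : realType) V & GRing.Lmodule R[i] V := {
  form : {dot V for Num.conj}
}.

HB.builders Context R V & Lmodule_isPreHilbert R V.

HB.instance Definition _ := Lmodule_isNormed.Build R[i] V
  (dot_normD form) (dot_normZ form) (@dot_norm_eq0 _ _ form).

Let form_norm (x : V) : form x x = `|x| ^+ 2.
Proof. by rewrite -dot_normK. Qed.

HB.instance Definition _ := NormedModule_isPreHilbert.Build R V form_norm.

HB.end.

Section UnconditionalSums.
Variables (R : realType) (V : choiceType).
Implicit Types (a b p q : V -> R) (c : R) (F G : V -> R[i]).
Local Notation Re := (@complex.Re R).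
Local Notation Im := (@complex.Im R).

Definition rsummable a := summable [set: V] (EFin \o a).

(* The unconditional sum of a real family; meaningful for summable ones only. *)
Definition rsum a : R :=
  fine (\esum_(v in [set: V]) (EFin \o a)^\+ v
        - \esum_(v in [set: V]) (EFin \o a)^\- v)%E.

Definition csummable F := rsummable (Re \o F) /\ rsummable (Im \o F).

Definition csum F : R[i] := rsum (Re \o F) +i* rsum (Im \o F).

Let S p := \esum_(v in [set: V]) (p v)%:E.

Lemma rsummableD a b : rsummable a -> rsummable b -> rsummable (fun v => a v + b v).
Proof. exact: summableD. Qed.

Lemma rsummable_le a b :
  (forall v, `|a v| <= `|b v|) -> rsummable b -> rsummable a.
Proof. by move=> ab; apply: le_lt_trans; apply: le_esum => v _; exact: ab. Qed.

Lemma rsummable_abs a : rsummable a -> rsummable (fun v => `|a v|).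
Proof. by apply: rsummable_le => v; rewrite normr_id. Qed.

Lemma rsummableN a : rsummable a -> rsummable (fun v => - a v).
Proof. by apply: rsummable_le => v; rewrite normrN. Qed.

Let S_ge0 p : (forall v, 0 <= p v) -> (0 <= S p)%E.
Proof. by move=> p0; apply: esum_ge0 => v _; rewrite lee_fin. Qed.

Lemma rsummableE p : (forall v, 0 <= p v) -> rsummable p = (S p < +oo)%E.
Proof.
move=> p0; congr (_ < _)%E; apply: eq_esum => v _ /=.
by rewrite ger0_norm.
Qed.

Let S_fin p : (forall v, 0 <= p v) -> rsummable p -> S p \is a fin_num.
Proof. by move=> p0; rewrite rsummableE// ge0_fin_numE// S_ge0. Qed.

Let S_le c p : 0 < c -> (forall v, 0 <= p v) ->
  (S (fun v => c * p v)%R <= c%:E * S p)%E.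
Proof.
move=> c0 p0; apply: ge_ereal_sup => _ [X [finX _]] <-.
rewrite [leLHS](_ : _ = c%:E * \sum_(v \in X) (p v)%:E)%E; last first.
  by rewrite ge0_mule_fsumr// => v; rewrite lee_fin.
rewrite lee_pmul2l// ?lte_fin//; apply: esum_ge; exists X => //.
Qed.

Let S_scale c p : 0 <= c -> (forall v, 0 <= p v) ->
  S (fun v => c * p v) = (c%:E * S p)%E.
Proof.
rewrite le_eqVlt => /predU1P[<- _|c0 p0].
  by rewrite mul0e /S esum1// => v _; rewrite mul0r.
apply/le_anti; rewrite S_le//=.
rewrite -lee_pdivlMl//; apply: le_trans (S_le _ _) => //; rewrite ?invr_gt0//.
  by apply: le_esum => v _; rewrite mulKf ?gt_eqF.
by move=> v; rewrite mulr_ge0// ltW.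
Qed.

Lemma rsummableZ c a : rsummable a -> rsummable (fun v => c * a v).
Proof.
move=> /rsummable_abs sa.
have : rsummable (fun v => `|c| * `|a v|).
  rewrite rsummableE => [|v]; last by rewrite mulr_ge0.
  rewrite S_scale// lte_mul_pinfty ?lee_fin//.
  by rewrite -rsummableE.
by apply: rsummable_le => v; rewrite -normrM normr_id.
Qed.

Let rsumB p q : (forall v, 0 <= p v) -> (forall v, 0 <= q v) ->
  rsummable p -> rsummable q ->
  rsum (fun v => p v - q v) = fine (S p) - fine (S q).
Proof.
move=> p0 q0 sp sq; rewrite -fineB ?S_fin// /rsum.
congr fine; apply: (esumB sp sq) => v _ /=; by rewrite lee_fin.
Qed.

Lemma rsum_ge0E p : (forall v, 0 <= p v) -> rsummable p -> rsum p = fine (S p).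
Proof.
move=> p0 sp; have s0 : rsummable (fun=> 0).
  by apply: rsummable_le sp => v; rewrite normr0.
rewrite -[LHS]/(rsum (fun v => p v)).
under eq_fun do rewrite -[p _]subr0.
rewrite rsumB// [X in _ - fine X]esum1 ?subr0//.
Qed.

Let absD_ge0 a v : 0 <= a v + `|a v|.
Proof. by have := ler_norm (- a v); rewrite normrN -subr_ge0 opprK addrC. Qed.

Let rsum_abs a : rsummable a ->
  rsum a = fine (S (fun v => a v + `|a v|)) - fine (S (fun v => `|a v|)).
Proof.
move=> sa; have sa' := rsummable_abs sa; rewrite -rsumB//; last first.
  exact: rsummableD.
by congr rsum; apply/funext => v; rewrite addrK.
Qed.

Let S_add p q : (forall v, 0 <= p v) -> (forall v, 0 <= q v) ->
  rsummable p -> rsummable q ->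
  fine (S (fun v => p v + q v)) = fine (S p) + fine (S q).
Proof.
move=> p0 q0 sp sq; rewrite -fineD ?S_fin//; congr fine.
by rewrite /S -esumD// => v _; rewrite lee_fin.
Qed.

Lemma rsumD a b : rsummable a -> rsummable b ->
  rsum (fun v => a v + b v) = rsum a + rsum b.
Proof.
move=> sa sb; rewrite (rsum_abs sa) (rsum_abs sb) addrACA -opprD.
have sa' := rsummable_abs sa; have sb' := rsummable_abs sb.
rewrite -!S_add//; try exact: rsummableD.
rewrite -rsumB//; last 3 first.
- by move=> v; rewrite addr_ge0.
- by apply: rsummableD; exact: rsummableD.
- exact: rsummableD.
by congr rsum; apply/funext => v; rewrite addrACA addrK.
Qed.

Lemma rsumN a : rsummable a -> rsum (fun v => - a v) = - rsum a.
Proof.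
move=> sa; have sa' := rsummable_abs sa.
rewrite (rsum_abs sa) opprB -rsumB//; last exact: rsummableD.
by congr rsum; apply/funext => v; rewrite opprD addrCA subrr addr0.
Qed.

Lemma rsumZ c a : rsummable a -> rsum (fun v => c * a v) = c * rsum a.
Proof.
move=> sa; have sa' := rsummable_abs sa.
wlog c0 : c / 0 <= c.
  move=> h; have [/h//|/ltW c0] := leP 0 c.
  rewrite -[c]opprK mulNr -h ?oppr_ge0// -rsumN; last exact: rsummableZ.
  by congr rsum; apply/funext => v; rewrite mulNr.
have fS p : (forall v, 0 <= p v) -> c * fine (S p) = fine (S (fun v => c * p v)).
  move=> p0; rewrite S_scale//; move: (S_ge0 p0); case: (S p) => //= _.
  have [->|/negPf c0'] := eqVneq c 0; first by rewrite mul0e mulr0.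
  by rewrite gt0_muley ?mulr0// lte_fin lt0r c0' c0.
rewrite (rsum_abs sa) mulrBr !fS// -rsumB//; last 4 first.
- by move=> v; rewrite mulr_ge0.
- by move=> v; rewrite mulr_ge0.
- by apply: rsummableZ; exact: rsummableD.
- exact: rsummableZ.
by congr rsum; apply/funext => v; rewrite mulrDr addrK.
Qed.

Lemma csumP (x : R[i]) F G : csummable F -> csummable G ->
  csum (fun v => x * F v + G v) = x * csum F + csum G.
Proof.
case: x => c d [sRF sIF] [sRG sIG]; apply/eqP; rewrite eq_complex /csum/=.
have e1 : Re \o (fun v => (c +i* d) * F v + G v) =
    fun v => (c * (Re \o F) v + (- d) * (Im \o F) v) + (Re \o G) v.
  by apply/funext => v /=; case: (F v) (G v) => [? ?] [? ?] /=; rewrite mulNr.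
have e2 : Im \o (fun v => (c +i* d) * F v + G v) =
    fun v => (c * (Im \o F) v + d * (Re \o F) v) + (Im \o G) v.
  by apply/funext => v /=; case: (F v) (G v) => [? ?] [? ?].
have sc := rsummableZ.
rewrite e1 e2; apply/andP; split; apply/eqP.
  rewrite rsumD//; last exact: rsummableD (sc _ _ sRF) (sc _ _ sIF).
  by rewrite (rsumD (sc _ _ sRF) (sc _ _ sIF)) !rsumZ// mulNr.
rewrite rsumD//; last exact: rsummableD (sc _ _ sIF) (sc _ _ sRF).
by rewrite (rsumD (sc _ _ sIF) (sc _ _ sRF)) !rsumZ.
Qed.

Lemma csum_conj F : csummable F -> csum (fun v => (F v)^*) = (csum F)^*.
Proof.
case=> sR sI; apply/eqP; rewrite eq_complex /csum/=.
have -> : Re \o (fun v => (F v)^*) = Re \o F.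
  by apply/funext => v /=; case: (F v).
have -> : Im \o (fun v => (F v)^*) = fun v => - (Im \o F) v.
  by apply/funext => v /=; case: (F v).
by rewrite rsumN// !eqxx.
Qed.

End UnconditionalSums.

Section SquareSummable.
Variables (R : realType) (V : choiceType).
Local Notation Re := (@complex.Re R).
Local Notation Im := (@complex.Im R).

Definition square_summable : {pred V -> R[i]^o} :=
  fun f => `[< rsummable (fun v => Re (`|f v| ^+ 2)) >].

Let nE (z : R[i]^o) : Re (`|z| ^+ 2) = Re z ^+ 2 + Im z ^+ 2.
Proof. by rewrite -add_Re2_Im2. Qed.

Let n_ge0 (z : R[i]^o) : 0 <= Re (`|z| ^+ 2).
Proof. by rewrite nE addr_ge0// sqr_ge0. Qed.

Lemma square_summable_closed : submod_closed square_summable.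
Proof.
split.
  apply/asboolP; have : rsummable (fun v : V => (0 : R)).
    by rewrite rsummableE ?esum1.
  by apply: rsummable_le => v; rewrite normr0 expr0n.
move=> a f g /asboolP sf /asboolP sg; apply/asboolP.
apply: rsummable_le (rsummableD (rsummableZ (2 * Re (`|a : R[i]^o| ^+ 2)) sf)
  (rsummableZ 2 sg)) => v.
rewrite (ger0_norm (n_ge0 _)); apply: le_trans (ler_norm _).
rewrite -[(a *: f + g) v]/(a * f v + g v) !nE.
case: a (f v) (g v) => [a1 a2] [f1 f2] [g1 g2] /=.
rewrite -subr_ge0 [leRHS](_ : _ = (a1 * f1 - a2 * f2 - g1) ^+ 2
  + (a1 * f2 + a2 * f1 - g2) ^+ 2); last by ring.
by rewrite addr_ge0// sqr_ge0.
Qed.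

HB.instance Definition _ :=
  GRing.isSubmodClosed.Build R[i] (V -> R[i]^o) square_summable square_summable_closed.

Record l2 := L2 { l2_fun :> V -> R[i]^o; l2_funP : l2_fun \in square_summable }.

HB.instance Definition _ := [isSub for l2_fun].
HB.instance Definition _ := [Choice of l2 by <:].
HB.instance Definition _ := [SubChoice_isSubLmodule of l2 by <:].

Definition l2_dot (f g : l2) : R[i] := csum (fun v => f v * (g v)^*).

Lemma l2_dot_summable (f g : l2) : csummable (fun v => f v * (g v)^*).
Proof.
have /asboolP sf := l2_funP f; have /asboolP sg := l2_funP g.
have le1 (x y : R) : 0 <= y -> - y <= x *+ 2 <= y -> `|x| <= `|y|.
  move=> y0 /andP[h1 h2]; rewrite (ger0_norm y0) ler_norml; apply/andP; split.
    by nra.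
  by nra.
split; apply: rsummable_le (rsummableD sf sg) => v; rewrite !nE /comp;
  rewrite -[Num.conj (g v)]/(conjc (g v));
  case: (f v) (g v) => [f1 f2] [g1 g2] /=;
  (apply: le1; first by rewrite !addr_ge0 ?sqr_ge0).
- have := sqr_ge0 (f1 + g1); have := sqr_ge0 (f2 + g2).
  have := sqr_ge0 (f1 - g1); have := sqr_ge0 (f2 - g2).
  by move=> *; apply/andP; split; nra.
- have := sqr_ge0 (f1 + g2); have := sqr_ge0 (f2 + g1).
  have := sqr_ge0 (f1 - g2); have := sqr_ge0 (f2 - g1).
  by move=> *; apply/andP; split; nra.
Qed.

Lemma l2_dotC f g : l2_dot f g = (l2_dot g f)^*.
Proof.
rewrite /l2_dot -csum_conj; last exact: l2_dot_summable.
by congr csum; apply/funext => v; rewrite rmorphM/= conjCK; exact: mulrC.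
Qed.

Lemma l2_dotP (a : R[i]) f g h : l2_dot (a *: f + g) h = a * l2_dot f h + l2_dot g h.
Proof.
rewrite /l2_dot -csumP; [|exact: l2_dot_summable..].
by congr csum; apply/funext => v; rewrite mulrA -mulrDl.
Qed.

Lemma l2_dot_bilinear : bilinear_for
  (GRing.Scale.Law.clone _ _ *%R _) (GRing.Scale.Law.clone _ _ (Num.conj \; *%R) _)
  l2_dot.
Proof.
split=> [g|f] a x y; first exact: l2_dotP.
by rewrite l2_dotC l2_dotP rmorphD rmorphM/= -!l2_dotC.
Qed.

HB.instance Definition _ := bilinear_isBilinear.Build R[i] l2 l2 R[i]
  _ _ l2_dot l2_dot_bilinear.

Let l2_dot_herm f g : l2_dot f g = (-1) ^+ false * (l2_dot g f)^*.
Proof. by rewrite expr0 mul1r -l2_dotC. Qed.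

HB.instance Definition _ := isHermitianSesquilinear.Build R[i] l2 false Num.conj
  l2_dot l2_dot_herm.

Lemma l2_dot_gt0 f : f != 0 -> 0 < l2_dot f f.
Proof.
move=> f0; have /asboolP sf := l2_funP f.
have [v fv0] : exists v, f v != 0.
  apply: contrapT => h; move/eqP: f0; apply; apply/val_inj/funext => v /=.
  by apply: contrapT => /eqP fv; apply: h; exists v.
have -> : l2_dot f f = (rsum (fun v => Re (`|f v| ^+ 2)))%:C.
  have e w : f w * (f w)^* = (Re (`|f w| ^+ 2))%:C.
    by rewrite -normCK nE add_Re2_Im2.
  apply/eqP; rewrite /l2_dot /csum eq_complex /=; apply/andP; split; apply/eqP.
    by congr rsum; apply/funext => w /=; rewrite e.
  rewrite [X in rsum X](_ : _ = fun w => 0 * Re (`|f w| ^+ 2)).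
    by rewrite rsumZ// mul0r.
  by apply/funext => w /=; rewrite e mul0r.
rewrite ltcR rsum_ge0E// -lte_fin fineK; last first.
  by rewrite ge0_fin_numE ?esum_ge0// -?rsummableE// => w _; rewrite lee_fin.
apply: (@lt_le_trans _ _ (Re (`|f v| ^+ 2))%:E).
  rewrite lte_fin lt0r n_ge0 andbT; apply: contra fv0 => /eqP h.
  by rewrite -normr_eq0 -sqrf_eq0 -add_Re2_Im2 -nE h.
apply: esum_ge; exists [set v]; first by split.
by rewrite fsbig_set1.
Qed.

HB.instance Definition _ := isDotProduct.Build R[i] l2 l2_dot l2_dot_gt0.

HB.instance Definition _ := Lmodule_isPreHilbert.Build R l2 l2_dot.

Lemma inner_l2E (f g : l2) : inner f g = csum (fun v => f v * (g v)^*).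
Proof. by []. Qed.

End SquareSummable.

Section DirectSum.
Variables (R : realType) (H K : preHilbertType R).

(* H * K already carries the maximum norm, hence the alias. *)
Definition hsum : Type := (H * K)%type.

HB.instance Definition _ := GRing.Lmodule.on hsum.

Definition hsum_dot (x y : hsum) : R[i] := inner x.1 y.1 + inner x.2 y.2.

Lemma hsum_dot_bilinear : bilinear_for
  (GRing.Scale.Law.clone _ _ *%R _) (GRing.Scale.Law.clone _ _ (Num.conj \; *%R) _)
  hsum_dot.
Proof.
split=> z a x y; rewrite /hsum_dot/=.
  by rewrite !linearPl mulrDr addrACA.
by rewrite !linearPr mulrDr addrACA.
Qed.

HB.instance Definition _ := bilinear_isBilinear.Build R[i] hsum hsum R[i]
  _ _ hsum_dot hsum_dot_bilinear.

Let hsum_dot_herm x y : hsum_dot x y = (-1) ^+ false * (hsum_dot y x)^*.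
Proof.
rewrite expr0 mul1r rmorphD /hsum_dot; congr (_ + _);
  by rewrite hermitian_subproof expr0 mul1r.
Qed.

HB.instance Definition _ := isHermitianSesquilinear.Build R[i] hsum false Num.conj
  hsum_dot hsum_dot_herm.

Lemma hsum_dot_gt0 x : x != 0 -> 0 < hsum_dot x x.
Proof.
move=> x0; rewrite lt_neqAle addr_ge0 ?dnorm_ge0// andbT eq_sym.
rewrite paddr_eq0 ?dnorm_ge0// !dnorm_eq0; apply: contra x0 => /andP[/eqP x1 /eqP x2].
by apply/eqP; case: x x1 x2 => x1 x2 /= -> ->.
Qed.

HB.instance Definition _ := isDotProduct.Build R[i] hsum hsum_dot hsum_dot_gt0.

HB.instance Definition _ := Lmodule_isPreHilbert.Build R hsum hsum_dot.

Lemma inner_hsumE (x y : hsum) : inner x y = inner x.1 y.1 + inner x.2 y.2.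
Proof. by []. Qed.

End DirectSum.

Section Operators.
Variable R : realType.
Implicit Types H K : preHilbertType R.

Definition bounded_operator H K (T : {linear H -> K}) :=
  exists M : R, forall x, `|T x| <= M%:C * `|x|.

Definition left_invertible H (T : {linear H -> H}) :=
  exists2 L : {linear H -> H}, bounded_operator L & cancel T L.

Definition is_adjoint H (T Tstar : H -> H) :=
  forall x y, inner (T x) y = inner x (Tstar y).

Definition rank_one H K (x : H) (y : K) : K -> H := fun h => inner h y *: x.

(* The operator matrix [[A, B], [0, D]]. *)
Definition upper_triangular H K (A : H -> H) (B : K -> H) (D : K -> K) :
  hsum H K -> hsum H K := fun x => (A x.1 + B x.2, D x.2).

Definition unitary H K (U : {linear H -> K}) :=
  (forall y, exists x, U x = y) /\ forall x y, inner (U x) (U y) = inner x y.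

Definition unitarily_equivalent H K (S : H -> H) (T : K -> K) :=
  exists2 U : {linear H -> K}, unitary U & forall x, U (S x) = T (U x).

End Operators.

Section HolomorphicFunctions.
Variable R : realType.

Definition disc (c : R[i]) (r : R) : set R[i]^o := ball (c : R[i]^o) r%:C.

Definition holomorphic_on (W : normedModType R[i]) (D : set R[i]^o)
    (f : R[i]^o -> W) := forall z, D z -> derivable f z 1.

(* A Hilbert space of W-valued holomorphic functions on D: an element h stands
   for the function holo_fun h, whose values outside D are irrelevant.  As an
   element is determined by its values on D and the operations are pointwise,
   this is a linear space of functions on D with a Hilbert space structure. *)
Record holoSpace (W : normedModType R[i]) (D : set R[i]^o) := HoloSpace {
  holo_space :> hilbertType R;
  holo_fun : {linear holo_space -> (R[i]^o -> W)};
  holo_fun_inj : forall h, (forall z, D z -> holo_fun h z = 0) -> h = 0;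
  holo_funP : forall h, holomorphic_on D (holo_fun h)
}.

Definition multiplication_by_coordinate (W : normedModType R[i])
    (D : set R[i]^o) (X : holoSpace W D) (M : X -> X) :=
  forall h z, D z -> holo_fun X (M h) z = z *: holo_fun X h z.

End HolomorphicFunctions.

Definition weighted_shift (R : realType) (V : countType) (e : rel V)
    (lambda : V -> R) (S : l2 R V -> l2 R V) :=
  forall f v, S f v = (lambda v)%:C * f (par e v).

(* Main.v *)
Require Import Defs.
From HB Require Import structures.
From mathcomp Require Import all_boot all_order all_algebra sesquilinear complex.
From mathcomp Require Import all_classical all_reals all_analysis.
From mathcomp Require Import ring.

Set Implicit Arguments.
Unset Strict Implicit.
Unset Printing Implicit Defensive.

Import Order.TTheory GRing.Theory Num.Theory.
Import numFieldNormedType.Exports.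

Local Open Scope classical_set_scope.
Local Open Scope complex_scope.
Local Open Scope card_scope.
Local Open Scope ring_scope.

(** Write omega_k for the k-th ancestor of omega and let D be the set of vertices
other than omega_1, omega_2, ...  The operator S maps l2(D) to itself, and it
moves the complementary basis backwards: e_(k+1) goes to a multiple of e_k, and
e_1 to a multiple of e_omega, since omega_k is the only child of omega_(k+1).
Hence, along l2(V) = l2(D) + l2(nat), the operator S is the block matrix with
corner T (the compression of S to l2(D)), off-diagonal part
h |-> lambda_omega <h, e_1> e_omega, and B, a weighted backward shift.  The vector
e_omega is orthogonal to the range of T because the parent of omega is not in
D, and B e_1 = 0.  What is left is to realize T and the adjoint F of B as
multiplication by the coordinate on spaces of holomorphic functions.

Both are instances of [holomorphic_model].  If T has a bounded left inverse L,
and A is a bounded operator whose kernel is the range of T, send h to the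
function z |-> A (1 - z L)^-1 h, that is the power series with coefficients
A L^n h.  Since A T = 0 and L T = 1, passing from h to T h shifts the
coefficients, i.e. multiplies the function by z.  If all A L^n h vanish, then
h = T^n L^n h for all n; so the model is faithful as soon as the ranges of the
T^n have trivial intersection.  Working with the resolvent instead of the series
makes holomorphy a consequence of the resolvent identity.

For T the operator A is the projection 1 - T L with values in l2(D); every
vertex of D reaches omega in finitely many steps to the parent, and T^(n+1) b
vanishes at the vertices of depth n ([off_spine_descends], [iter_compression_eq0]),
which gives the trivial intersection.  For F the operator A is the evaluation at
0, with scalar values; the left inverse is a backward shift with the inverse
weights, bounded because left invertibility of S bounds the weights at the
omega_k from below ([left_invertible_spine]).

The Hilbert space part rests on one criterion, [l2_of_sum_le]: a family whose
finite square sums are at most c is an element of l2 of squared norm at most c.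
Completeness, adjoints and weighted restrictions all follow from it. *)

(** * Norms in l2 through finite sums *)

Section L2Norm.
Variables (R : realType) (V : choiceType).
Local Notation Re := (@complex.Re R).
Implicit Types (f g : l2 R V) (s : seq V).

Lemma Re_normsq_ge0 (z : R[i]) : 0 <= Re (`|z| ^+ 2).
Proof. by rewrite -add_Re2_Im2/= addr_ge0// sqr_ge0. Qed.

Lemma Re_normsqK (z : R[i]) : (Re (`|z| ^+ 2))%:C = `|z| ^+ 2.
Proof. by rewrite -add_Re2_Im2. Qed.

Lemma l2_normE f :
  `|f| ^+ 2 = (fine (\esum_(v in [set: V]) (Re (`|f v : R[i]| ^+ 2))%:E))%:C.
Proof.
rewrite -inner_norm inner_l2E.
have e w : f w * (f w)^* = (Re (`|f w : R[i]| ^+ 2))%:C.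
  by rewrite Re_normsqK normCK.
have /asboolP sf := l2_funP f.
rewrite -rsum_ge0E//; last by move=> v; exact: Re_normsq_ge0.
apply/eqP; rewrite /csum eq_complex /=; apply/andP; split; apply/eqP.
  by congr rsum; apply/funext => w /=; rewrite e.
rewrite [X in rsum X](_ : _ = fun w => 0 * Re (`|f w : R[i]| ^+ 2)).
  by rewrite rsumZ// mul0r.
by apply/funext => w /=; rewrite e mul0r.
Qed.

Lemma l2_esum_fin f :
  \esum_(v in [set: V]) (Re (`|f v : R[i]| ^+ 2))%:E \is a fin_num.
Proof.
have /asboolP sf := l2_funP f.
rewrite ge0_fin_numE; last first.
  by apply: esum_ge0 => v _; rewrite lee_fin Re_normsq_ge0.
by rewrite -rsummableE// => v; exact: Re_normsq_ge0.
Qed.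

Lemma l2_sum_le f s : uniq s -> \sum_(v <- s) `|f v : R[i]| ^+ 2 <= `|f| ^+ 2.
Proof.
move=> us; rewrite l2_normE.
under eq_bigr do rewrite -Re_normsqK.
rewrite -rmorph_sum/= lecR -lee_fin fineK ?l2_esum_fin//.
apply: esum_ge; exists [set` s]; first by split=> //; exact: finite_seq.
by rewrite -fsbig_seq// sumEFin.
Qed.

Lemma l2_ext f g : (forall v, f v = g v) -> f = g.
Proof. by move=> fg; apply/val_inj/funext. Qed.

(** Basis vectors, limits, adjoints and weighted compositions are all obtained from
this criterion, so that only finite sums ever have to be estimated. *)
Lemma l2_of_sum_le (F : V -> R[i]) (c : R) :
  (forall s, uniq s -> \sum_(v <- s) `|F v| ^+ 2 <= c%:C) ->
  exists2 g : l2 R V, (forall v, g v = F v) & `|g| ^+ 2 <= c%:C.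
Proof.
move=> Fc.
have le_c : (\esum_(v in [set: V]) (Re (`|F v| ^+ 2))%:E <= c%:E)%E.
  apply: ge_ereal_sup => _ [X [finX _]] <-.
  rewrite fsbig_finite//= sumEFin lee_fin -lecR rmorph_sum/=.
  by under eq_bigr do rewrite Re_normsqK; apply: Fc.
have FP : (F : V -> R[i]^o) \in @square_summable R V.
  apply/asboolP; rewrite rsummableE; last by move=> v; exact: Re_normsq_ge0.
  by apply: le_lt_trans le_c _; rewrite ltry.
exists (L2 FP) => //.
by rewrite l2_normE lecR -lee_fin fineK// l2_esum_fin.
Qed.

Lemma l2_coord_le f v : `|f v : R[i]| <= `|f|.
Proof.
rewrite -(@ler_pXn2r _ 2) ?nnegrE//.
by have := @l2_sum_le f [:: v] isT; rewrite big_seq1.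
Qed.

End L2Norm.

(** * The canonical basis of l2 *)

Section L2Basis.
Variables (R : realType) (V : choiceType).
Implicit Types (f : l2 R V) (u v : V).

Lemma esum_single (a : V -> \bar R) u : (0 <= a u)%E ->
  (forall v, v != u -> a v = 0%E) -> \esum_(v in [set: V]) a v = a u.
Proof.
move=> au0 a0; rewrite -[RHS]esum_set1// esum_mkcond [RHS]esum_mkcond.
apply: eq_esum => v _; rewrite in_setT; case: ifPn => //.
by rewrite notin_setE => /eqP /a0.
Qed.

Lemma rsum_single (a : V -> R) u : (forall v, v != u -> a v = 0) ->
  rsum a = a u.
Proof.
move=> a0; rewrite /rsum !(@esum_single _ u).
- rewrite funeposE funenegE /=; have [au|au] := leP 0 (a u).
    by rewrite (max_idPl _) ?lee_fin// (max_idPr _) ?sube0// lee_fin oppr_le0.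
  rewrite (max_idPr _) ?lee_fin ?ltW// (max_idPl _) ?lee_fin ?oppr_ge0 ?ltW//.
  by rewrite sub0e/= opprK.
- by rewrite funeneg_ge0.
- by move=> v /a0 h; rewrite funenegE /= h oppr0 maxxx.
- by rewrite funepos_ge0.
- by move=> v /a0 h; rewrite funeposE /= h maxxx.
Qed.

Lemma csum_single (F : V -> R[i]) u : (forall v, v != u -> F v = 0) ->
  csum F = F u.
Proof.
move=> F0; rewrite /csum !(@rsum_single _ u) => [|v /F0 /= ->//|v /F0 /= ->//].
by rewrite /=; case: (F u).
Qed.

Let delta_ex u : exists2 g : l2 R V,
  (forall v, g v = (v == u)%:R) & `|g| ^+ 2 <= (1 : R)%:C.
Proof.
apply: l2_of_sum_le => s us; rewrite (bigID (pred1 u))/= addrC big1 ?add0r.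
  rewrite (eq_bigr (fun=> 1)) => [|v /eqP ->]; last by rewrite eqxx normr1 expr1n.
  rewrite -big_filter big_const_seq count_predT size_filter.
  by rewrite (count_uniq_mem _ us) iter_addr_0 -[1%:C]/(1 : R[i]); case: (u \in s); rewrite ?ler01.
by move=> v /negPf ->; rewrite normr0 expr0n.
Qed.

Definition l2_delta u : l2 R V := sval (cid2 (delta_ex u)).

Lemma l2_deltaE u v : l2_delta u v = (v == u)%:R.
Proof. by rewrite /l2_delta; case: cid2. Qed.

Lemma l2_delta_norm u : `|l2_delta u| = 1.
Proof.
apply/le_anti/andP; split.
  rewrite -(@ler_pXn2r _ 2) ?nnegrE// expr1n /l2_delta.
  by case: cid2.
by apply: le_trans (l2_coord_le _ u); rewrite l2_deltaE eqxx normr1.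
Qed.

Lemma inner_delta f u : inner f (l2_delta u) = f u.
Proof.
rewrite inner_l2E (@csum_single _ u) => [|v /negPf vu].
  by rewrite l2_deltaE eqxx conjC1 mulr1.
by rewrite l2_deltaE vu conjC0 mulr0.
Qed.

End L2Basis.
Arguments l2_delta {R V}.

(** * Completeness of l2 *)

Section L2Complete.
Variables (R : realType) (V : choiceType).
Local Notation Re := (@complex.Re R).
Local Notation Im := (@complex.Im R).

Lemma normc_ge_Re (z : R[i]) : (`|Re z|)%:C <= `|z|.
Proof.
rewrite -(@ler_pXn2r _ 2) ?nnegrE ?normr_ge0 ?ler0c// -add_Re2_Im2 -rmorphXn lecR.
by rewrite real_normK ?num_real// lerDl sqr_ge0.
Qed.

Lemma normc_ge_Im (z : R[i]) : (`|Im z|)%:C <= `|z|.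
Proof.
rewrite -(@ler_pXn2r _ 2) ?nnegrE ?normr_ge0 ?ler0c// -add_Re2_Im2 -rmorphXn lecR.
by rewrite real_normK ?num_real// lerDr sqr_ge0.
Qed.

Lemma posc_Re (eps : R[i]) : 0 < eps -> 0 < Re eps /\ eps = (Re eps)%:C.
Proof. by case: eps => a b; rewrite ltcE/= => /andP[/eqP -> a0]. Qed.

(** The limit G is taken coordinatewise; bounding the finite square sums of x - G,
for x in a set of the filter of radius eps, yields at once that x - G is in l2
and that its norm is at most eps. *)
Lemma l2_complete (F : set_system (l2 R V)) :
  ProperFilter F -> cauchy F -> cvg F.
Proof.
move=> FF /cauchyP cF.
have cauchyF (eps : R) : 0 < eps -> exists x : l2 R V, F (ball x eps%:C).
  by move=> e0; apply: cF; rewrite ltcR.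
have cvg_part (p : R[i] -> R) :
    {morph p : x y / x - y} -> (forall z, (`|p z|)%:C <= `|z|) ->
    forall v, cvg ((fun x : l2 R V => p (x v)) @ F).
  move=> pB p_le v; apply: cauchy_cvg; apply: cauchy_exP => eps e0.
  have [x Fx] := cauchyF _ e0; exists (p (x v)).
  change (F [set y : l2 R V | ball (p (x v)) eps (p (y v))]).
  apply: filterS Fx => y; rewrite -!ball_normE/= => xy.
  rewrite -pB -ltcR (le_lt_trans (p_le _))// (le_lt_trans _ xy)//.
  exact: (l2_coord_le (x - y)).
have cRe := cvg_part Re (@raddfB _ _ _) normc_ge_Re.
have cIm := cvg_part Im (@raddfB _ _ _) normc_ge_Im.
pose G v : R[i] := lim ((fun x : l2 R V => Re (x v)) @ F)
                +i* lim ((fun x : l2 R V => Im (x v)) @ F).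
(* finite sums pass to the limit along F, so the bound on x - y holds for x - G *)
have dist_le (eps : R) (x : l2 R V) : 0 < eps -> F (ball x eps%:C) ->
    exists2 d : l2 R V, (forall v, d v = x v - G v) & `|d| <= eps%:C.
  move=> e0 Fx.
  have [s us|d dE d_le] := @l2_of_sum_le R V (fun v => x v - G v) (eps ^+ 2).
    pose q (y : l2 R V) : R :=
      \sum_(v <- s) ((Re (x v) - Re (y v)) ^+ 2 + (Im (x v) - Im (y v)) ^+ 2).
    have qE (y : V -> R[i]) : (\sum_(v <- s)
        ((Re (x v) - Re (y v)) ^+ 2 + (Im (x v) - Im (y v)) ^+ 2))%:C
        = \sum_(v <- s) `|x v - y v| ^+ 2.
      by rewrite rmorph_sum/=; apply: eq_bigr => v _; rewrite -add_Re2_Im2 !raddfB.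
    rewrite -qE lecR.
    have cq : q y @[y --> F] --> \sum_(v <- s)
        ((Re (x v) - Re (G v)) ^+ 2 + (Im (x v) - Im (G v)) ^+ 2).
      apply: cvg_big => [|v _]; first exact: add_continuous.
      apply: cvgD; rewrite expr2;
        under eq_fun do rewrite expr2; apply: cvgM; apply: cvgB;
        try exact: cvg_cst; [exact: cRe|exact: cRe|exact: cIm|exact: cIm].
    apply: (cvgr_to_le cq).
    apply: filterS Fx => y; rewrite -ball_normE/= => xy.
    rewrite -lecR qE (le_trans (@l2_sum_le _ _ (x - y) s us))//.
    by rewrite rmorphXn/= ler_pXn2r ?nnegrE ?normr_ge0 ?ler0c ?ltW.
  exists d => //; move: d_le; rewrite rmorphXn/=.
  by rewrite ler_pXn2r ?nnegrE ?normr_ge0 ?ler0c ?(ltW e0).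
have [x1 Fx1] := cauchyF 1 ltr01.
have [d1 d1E _] := dist_le _ _ ltr01 Fx1.
have limE v : (x1 - d1) v = G v by rewrite [LHS]/(x1 v - d1 v) d1E; exact: subKr.
apply/cvg_ex; exists (x1 - d1); apply/cvgrPdist_lt => eps.
move=> /posc_Re[]; set r := Re eps => r0 ->.
have r20 : 0 < r / 2 by rewrite divr_gt0.
have [x Fx] := cauchyF _ r20; have [d dE d_le] := dist_le _ _ r20 Fx.
apply: filterS Fx => y; rewrite -ball_normE/= => xy.
have -> : x1 - d1 - y = (x - y) - d.
  apply: l2_ext => v; rewrite [LHS]/((x1 - d1) v - y v) limE.
  rewrite [RHS]/(x v - y v - d v) dE.
  suff /(_ (x v) (y v) (G v)) : forall a b c : R[i], c - b = a - b - (a - c) by [].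
  by move=> a b c; ring.
rewrite (le_lt_trans (ler_normB _ _))// (splitr r) rmorphD/=.
by rewrite ltr_leD.
Qed.

HB.instance Definition _ := Uniform_isComplete.Build (l2 R V) l2_complete.

End L2Complete.

(** * Inner product spaces *)

Section PreHilbertFacts.
Variable R : realType.
Local Notation Re := (@complex.Re R).

Lemma linear_pack (U W : lmodType R[i]) (f : U -> W) :
  linear f -> exists T : {linear U -> W}, forall x, T x = f x.
Proof.
move=> lf.
pose m := GRing.isLinear.Build _ _ _ _ f lf.
by exists (HB.pack_for {linear U -> W} f m).
Qed.

Variables H K : preHilbertType R.

Lemma normE_Re (x : H) : `|x| = (Re `|x|)%:C.
Proof. by rewrite RRe_real// realE normr_ge0. Qed.

Lemma inner_conj (x y : H) : inner x y = (inner y x)^*.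
Proof. by rewrite hermitian_subproof expr0 mul1r. Qed.

Lemma cauchy_schwarz (x y : H) : `|inner x y| <= `|x| * `|y|.
Proof.
have nE (z : H) : dot_norm inner z = `|z|.
  by rewrite /dot_norm inner_norm sqrCK.
by rewrite -!nE dot_cauchy_schwarz.
Qed.

Lemma is_adjoint_sym (T Tstar : H -> H) : is_adjoint T Tstar -> is_adjoint Tstar T.
Proof. by move=> adj x y; rewrite inner_conj -adj -inner_conj. Qed.

(** Polarization: applied to x and to 'i x, the norm determines the real and the
imaginary parts of the inner product. *)
Lemma isometry_inner (U : {linear H -> K}) :
  (forall x, `|U x| = `|x|) -> forall x y, inner (U x) (U y) = inner x y.
Proof.
move=> isoU; have eqD x y : inner (U x) (U y) + (inner (U x) (U y))^* =
    inner x y + (inner x y)^*.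
  have := dnormD inner (U x) (U y); rewrite /= -linearD !inner_norm !isoU.
  rewrite -!inner_norm dnormD => /addrI ->//.
move=> x y; have e1 := eqD x y; have e2 := eqD ('i%C *: x) y.
move: e2; rewrite linearZ !linearZl_LR/= !rmorphM/=.
move: e1; rewrite -!['i%C]/('i) conjCi.
set a := inner (U x) (U y); set b := inner x y => e1 e2.
have {}e2 : a - a^* = b - b^*.
  by apply: (mulfI (neq0Ci _)); rewrite !mulrBr -!mulNr.
have : a *+ 2 = b *+ 2.
  have -> : a *+ 2 = (a + a^*) + (a - a^*) by ring.
  by rewrite e1 e2; ring.
by move/eqP; rewrite eqrMn2r// => /eqP.
Qed.

End PreHilbertFacts.

(** * Bounded operators on l2 *)

Section L2Operators.
Variable R : realType.
Local Notation Re := (@complex.Re R).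
Implicit Types V : choiceType.

Definition l2_trunc V (F : V -> R[i]) (s : seq V) : l2 R V :=
  \sum_(v <- s) F v *: l2_delta v.

Lemma pythagoras (H : preHilbertType R) (x p : H) :
  inner x p = `|p| ^+ 2 -> `|x - p| ^+ 2 = `|x| ^+ 2 - `|p| ^+ 2.
Proof.
move=> xp; rewrite -[LHS]inner_norm linearBl/= !linearBr/= [inner p x]inner_conj.
by rewrite xp !inner_norm conj_Creal ?subrr ?subr0// ger0_real// exprn_ge0.
Qed.

Lemma inner_trunc V (f : l2 R V) (F : V -> R[i]) s :
  inner f (l2_trunc F s) = \sum_(v <- s) f v * (F v)^*.
Proof.
rewrite linear_sumr; apply: eq_bigr => v _.
by rewrite linearZr_LR/= inner_delta mulrC.
Qed.

Lemma l2_truncE V (F : V -> R[i]) s v : uniq s -> v \in s -> l2_trunc F s v = F v.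
Proof.
move=> us vs; rewrite -inner_delta /l2_trunc linear_sumlz/= (bigD1_seq v)//=.
rewrite linearZl_LR/= inner_delta l2_deltaE eqxx mulr1 big1 ?addr0// => w wv.
by rewrite linearZl_LR/= inner_delta l2_deltaE eq_sym (negPf wv) mulr0.
Qed.

Lemma l2_trunc_norm V (F : V -> R[i]) s : uniq s ->
  `|l2_trunc F s| ^+ 2 = \sum_(v <- s) `|F v| ^+ 2.
Proof.
move=> us; rewrite -inner_norm inner_trunc; apply: eq_big_seq => v vs.
by rewrite l2_truncE// normCK.
Qed.

Lemma l2_trunc_dist V (f : l2 R V) s : uniq s ->
  `|f - l2_trunc f s| ^+ 2 = `|f| ^+ 2 - \sum_(v <- s) `|f v : R[i]| ^+ 2.
Proof.
move=> us; set p := l2_trunc f s.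
have fp : inner f p = `|p| ^+ 2.
  rewrite l2_trunc_norm// inner_trunc; apply: eq_bigr => v _.
  by rewrite normCK.
by rewrite (pythagoras fp); congr (_ - _); exact: l2_trunc_norm.
Qed.

Lemma ReK_ge0 (x : R[i]) : 0 <= x -> (Re x)%:C = x.
Proof. by move=> x0; rewrite RRe_real// ger0_real. Qed.

(** If all truncations stayed at distance eps from f, the finite square sums of f
would be at most |f|^2 - eps, hence so would be |f|^2. *)
Lemma l2_trunc_dense V (f : l2 R V) (eps : R) : 0 < eps ->
  exists2 s, uniq s & `|f - l2_trunc f s| ^+ 2 <= eps%:C.
Proof.
move=> e0; apply: contrapT => /forall2NP far.
have [s us|g gE] := @l2_of_sum_le R V f (Re (`|f| ^+ 2) - eps).
  rewrite rmorphB/= ReK_ge0 ?exprn_ge0//.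
  have [//|/negP] := far s; rewrite -real_ltNge; last 2 first.
  - by rewrite ger0_real// ler0c ltW.
  - by rewrite ger0_real// exprn_ge0.
  by rewrite l2_trunc_dist// ltrBrDl -ltrBrDr => /ltW.
rewrite (l2_ext gE) rmorphB/= ReK_ge0 ?exprn_ge0//.
rewrite -subr_ge0 addrAC subrr add0r -rmorphN/= ler0c oppr_ge0 => e0'.
by have := lt_le_trans e0 e0'; rewrite ltxx.
Qed.

Lemma l2_delta_eq0 V (W : normedModType R[i]) (phi : {linear l2 R V -> W}) (C : R) :
  (forall f, `|phi f| <= C%:C * `|f|) -> (forall v, phi (l2_delta v) = 0) ->
  forall f, phi f = 0.
Proof.
move=> phiC phi0 f; apply/eqP; rewrite -normr_eq0 -sqrf_eq0.
rewrite -(ReK_ge0 (exprn_ge0 2 (normr_ge0 _))).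
set a := Re _; have a0 : 0 <= a by rewrite -ler0c ReK_ge0 ?exprn_ge0.
suff : a <= 0.
  by move=> a0'; rewrite (_ : a = 0)//; apply/le_anti; rewrite a0'.
apply/ler_addgt0Pr => eps e0; rewrite add0r.
have d0 : 0 < eps / (C ^+ 2 + 1) by rewrite divr_gt0// ltr_wpDl// sqr_ge0.
have [s us fs] := l2_trunc_dense f d0.
have phiE : phi f = phi (f - l2_trunc f s).
  rewrite linearB /l2_trunc linear_sum big1 ?subr0// => v _.
  by rewrite linearZ/= phi0 scaler0.
rewrite -lecR ReK_ge0 ?exprn_ge0// phiE (@le_trans _ _ ((C ^+ 2)%:C * (eps / (C ^+ 2 + 1))%:C))//.
  rewrite (le_trans _ (ler_wpM2l _ fs))// ?ler0c ?sqr_ge0// rmorphXn/= -exprMn.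
  have := phiC (f - l2_trunc f s); move=> h; rewrite ler_pXn2r// nnegrE//.
  exact: le_trans h.
rewrite -rmorphM lecR mulrA ler_pdivrMr ?ltr_wpDl ?sqr_ge0//.
by rewrite mulrC ler_pM2l// lerDl.
Qed.

Lemma bounded_ge0 (H K : preHilbertType R) (T : {linear H -> K}) :
  bounded_operator T -> exists2 C : R, 0 <= C & forall x, `|T x| <= C%:C * `|x|.
Proof.
case=> C TC; exists `|C| => // x; apply: le_trans (TC x) _.
by rewrite ler_wpM2r// lecR ler_norm.
Qed.

(** The adjoint must send y to the family <y, T e_v>.  Its truncation p to a finite
set satisfies |p|^2 = <y, T p> <= C |y| |p|, which bounds the finite square sums.
The adjunction then holds on the basis, hence everywhere by density. *)
Lemma l2_adjoint V (T : {linear l2 R V -> l2 R V}) : bounded_operator T ->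
  exists Tstar : {linear l2 R V -> l2 R V},
    bounded_operator Tstar /\ is_adjoint T Tstar.
Proof.
move=> /bounded_ge0[C C0 TC].
pose F y v := inner y (T (l2_delta v)).
have F_ex y : exists2 g : l2 R V, (forall v, g v = F y v) &
    `|g| ^+ 2 <= ((C * Re `|y|) ^+ 2)%:C.
  apply: l2_of_sum_le => s us; rewrite -l2_trunc_norm//.
  set p := l2_trunc (F y) s; rewrite rmorphXn rmorphM/= -normE_Re.
  have Cy0 : 0 <= C%:C * `|y| by rewrite mulr_ge0 ?ler0c.
  rewrite ler_pXn2r ?nnegrE//.
  have [->|p0] := eqVneq p 0; first by rewrite normr0.
  have ip : inner y (T p) = `|p| ^+ 2.
    rewrite l2_trunc_norm// /p /l2_trunc !linear_sum.
    apply: eq_bigr => v _.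
    rewrite -[LHS]/(inner y (T (F y v *: l2_delta v))) linearZ linearZr_LR.
    by rewrite -[LHS]/((F y v)^* * F y v) normCK mulrC.
  have := cauchy_schwarz y (T p); rewrite ip normrX normr_id => h.
  have : `|p| * `|p| <= C%:C * `|y| * `|p|.
    by rewrite -expr2 (le_trans h)// [leRHS]mulrAC [leLHS]mulrC ler_wpM2r.
  by rewrite ler_pM2r// normr_gt0.
pose G y := sval (cid2 (F_ex y)).
have GE y v : G y v = F y v by rewrite /G; case: cid2.
have G_le y : `|G y| <= C%:C * `|y|.
  rewrite -(@ler_pXn2r _ 2) ?nnegrE ?mulr_ge0 ?ler0c//.
  have : `|G y| ^+ 2 <= ((C * Re `|y|) ^+ 2)%:C by rewrite /G; case: cid2.
  by rewrite rmorphXn rmorphM/= -normE_Re.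
have [Tstar TE] : exists Tstar : {linear l2 R V -> l2 R V}, forall y, Tstar y = G y.
  apply: linear_pack => a x y; apply: l2_ext => v.
  by rewrite [RHS]/(a * G x v + G y v) !GE /F linearPl.
exists Tstar; split; first by exists C => y; rewrite TE.
move=> x y; rewrite TE; apply/eqP; rewrite -subr_eq0; apply/eqP.
have [phi phiE] : exists phi : {linear l2 R V -> R[i]^o},
    forall x, phi x = inner (T x) y - inner x (G y).
  apply: linear_pack => a u v; rewrite linearP !linearPl/=.
  rewrite [in RHS]/GRing.scale/=; ring.
suff phi0 : forall x, phi x = 0 by rewrite -phiE; exact: phi0.
apply: (@l2_delta_eq0 _ _ phi (C * Re `|y| + Re `|G y|)) => [u|v].
  rewrite phiE (le_trans (ler_normB _ _))// rmorphD rmorphM/= -!normE_Re mulrDl.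
  rewrite lerD ?(le_trans (cauchy_schwarz _ _))//; last by rewrite mulrC.
  by rewrite mulrAC ler_wpM2r.
rewrite phiE [X in _ - X]inner_conj inner_delta GE /F -inner_conj.
exact: subrr.
Qed.

(** A partial injection sigma followed by multiplication by bounded weights; it
covers restrictions, extensions by zero and weighted shifts of sequences. *)
Lemma l2_weighted_comp V V' (sigma : V' -> option V) (w : V' -> R[i]) (C : R) :
  (forall a b v, sigma a = Some v -> sigma b = Some v -> a = b) ->
  (forall a, `|w a| <= C%:C) ->
  exists T : {linear l2 R V -> l2 R V'}, bounded_operator T /\
    forall f a, T f a = w a * (if sigma a is Some v then f v : R[i] else 0).
Proof.
move=> sigma_inj wC.
have C0 (a : V') : 0 <= C%:C :> R[i] by apply: le_trans (wC a).
pose F (f : l2 R V) a : R[i] := w a * (if sigma a is Some v then f v : R[i] else 0).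
have F_ex f : exists2 g : l2 R V', (forall a, g a = F f a) &
    `|g| ^+ 2 <= ((C * Re `|f|) ^+ 2)%:C.
  apply: l2_of_sum_le => s us; rewrite rmorphXn rmorphM/= -normE_Re exprMn.
  have us' : uniq (pmap sigma s).
    elim: s us => //= a s IHs /andP[a_s /IHs us].
    case sa : (sigma a) => [v|]//=; rewrite us andbT.
    apply: contra a_s; rewrite mem_pmap => /mapP[b bs sb].
    by rewrite (sigma_inj a b v).
  have sumE : \sum_(a <- s) `|if sigma a is Some v then f v : R[i] else 0| ^+ 2
      = \sum_(v <- pmap sigma s) `|f v : R[i]| ^+ 2.
    elim: s {us us'} => [|a s IHs]; rewrite ?big_nil// big_cons IHs/=.
    by case: (sigma a) => [v|]/=; rewrite ?big_cons// normr0 expr0n add0r.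
  rewrite (le_trans _ (ler_wpM2l _ (l2_sum_le f us')))//; last first.
    by rewrite -rmorphXn ler0c sqr_ge0.
  rewrite -sumE mulr_sumr; apply: ler_sum => a _.
  rewrite /F normrM exprMn ler_wpM2r ?exprn_ge0//.
  by rewrite ler_pXn2r ?nnegrE ?(C0 a).
pose G f := sval (cid2 (F_ex f)).
have GE f a : G f a = F f a by rewrite /G; case: cid2.
have [T TE] : exists T : {linear l2 R V -> l2 R V'}, forall f, T f = G f.
  apply: linear_pack => c f g; apply: l2_ext => a.
  rewrite [RHS]/(c * G f a + G g a) !GE /F; case: (sigma a) => [v|]; last first.
    suff /(_ (w a) c) : forall p q : R[i], p * 0 = q * (p * 0) + p * 0 by [].
    by move=> *; ring.
  rewrite [(c *: f + g) v]/(c * f v + g v).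
  suff /(_ (w a) c (f v) (g v)) : forall p q x y : R[i],
      p * (q * x + y) = q * (p * x) + p * y by [].
  by move=> *; ring.
exists T; split=> [|f a]; last by rewrite TE GE.
exists `|C| => f; rewrite TE -(@ler_pXn2r _ 2) ?nnegrE ?mulr_ge0 ?ler0c//.
have : `|G f| ^+ 2 <= ((C * Re `|f|) ^+ 2)%:C by rewrite /G; case: cid2.
rewrite rmorphXn rmorphM/= -normE_Re => h; apply: le_trans h _.
by rewrite !exprMn -!rmorphXn real_normK ?num_real.
Qed.

End L2Operators.

(** * Resolvent of a bounded operator *)

Section Resolvent.
Variables (R : realType) (X : completeNormedModType R[i]).
Local Notation Re := (@complex.Re R).

(** Neumann series in the form of a fixed point iteration y |-> h + L y. *)
Lemma half_contraction_solve (L : {linear X -> X}) :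
  (forall x, `|L x| <= 2^-1 * `|x|) -> forall h, exists y, y = h + L y.
Proof.
move=> Lhalf h; pose u n := iter n (fun y => h + L y) 0.
have u_le n : `|u n| <= 2 * `|h|.
  elim: n => [|n IHn]; first by rewrite normr0 mulr_ge0.
  rewrite /u iterS -/(u n) (le_trans (ler_normD _ _))//.
  rewrite [leRHS](_ : _ = `|h| + 2^-1 * (2 * `|h|)); last first.
    by rewrite mulKf ?pnatr_eq0// mulr_natl mulr2n.
  by rewrite lerD2l (le_trans (Lhalf _))// ler_wpM2l ?invr_ge0.
have u_dist n m : `|u n - u (n + m)%N| <= 2^-1 ^+ n * (2 * `|h|).
  elim: n => [|n IHn]; first by rewrite add0n sub0r normrN expr0 mul1r.
  rewrite addSn /u !iterS -/(u n) -/(u (n + m)%N) opprD addrACA subrr add0r -linearB.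
  by rewrite (le_trans (Lhalf _))// exprS -mulrA ler_wpM2l ?invr_ge0.
have : cvg (u n @[n --> \oo]).
  apply: cauchy_cvg; apply: cauchy_exP => eps /posc_Re[]; set e := Re eps => e0 ->.
  set a := 2 * Re `|h|.
  have a0 : 0 <= a by rewrite mulr_ge0// -ler0c ReK_ge0.
  have [n an] : exists n : nat, a < e * 2 ^+ n.
    exists (Num.bound (a / e)); rewrite -ltr_pdivrMl// mulrC.
    apply: (lt_le_trans (archi_boundP _)); first by rewrite divr_ge0// ltW.
    by rewrite -natrX ler_nat ltnW// ltn_expl.
  exists (u n), n => // m /= /subnKC <-; rewrite -ball_normE/=.
  apply: (le_lt_trans (u_dist _ _)).
  rewrite exprVn mulrC ltr_pdivrMr ?exprn_gt0//.
  have -> : 2 * `|h| = a%:C by rewrite rmorphM/= ReK_ge0// rmorph_nat.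
  by rewrite -(rmorph_nat (real_complex R)) -rmorphXn -rmorphM ltcR.
move=> /cvg_ex[l ul]; exists l; apply/eqP; rewrite -subr_eq0 -normr_eq0.
apply/negPn/negP => n0; set d := `|_| in n0.
have d0 : 0 < d / 2 by rewrite divr_gt0// lt0r n0 normr_ge0.
move/cvgrPdist_lt : ul => /(_ _ d0)[N _ uN].
suff : d < d by rewrite ltxx.
rewrite [ltRHS](splitr d) {1}/d.
have -> : l - (h + L l) = (l - u N.+1) - L (l - u N).
  rewrite /u iterS -/(u N) linearB.
  by rewrite opprB [in RHS]opprD !addrA subrK opprD addrA.
rewrite (le_lt_trans (ler_normB _ _))// ltr_leD ?uN/=//.
rewrite (le_trans (Lhalf _))// (le_trans _ (ltW (uN N _)))//=.
by rewrite ler_piMl// invf_le1// ler1n.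
Qed.

Variables (L : {linear X -> X}) (C : R).
Hypotheses (C0 : 0 < C) (LC : forall x, `|L x| <= C%:C * `|x|).

(** The value (1 - z L)^-1 h; it is meaningful for |z| < 1 / (2 C), where z L is a
contraction of ratio 1/2. *)
Definition resolvent (z : R[i]) (h : X) : X := xget 0 [set y | y = h + z *: L y].

Local Notation r := ((2 * C)^-1).

Lemma disc0E (s : R) (z : R[i]) : disc 0 s z = (`|z| < s%:C) :> Prop.
Proof. by rewrite /disc -ball_normE/= sub0r normrN. Qed.

Lemma scale_half z x : `|z| < r%:C -> `|z *: L x| <= 2^-1 * `|x|.
Proof.
move=> zr; rewrite normrZ (le_trans (ler_pM _ _ (ltW zr) (LC x)))//.
by rewrite mulrA -rmorphM/= invfM divfK ?gt_eqF// fmorphV rmorph_nat.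
Qed.

Lemma half_contraction_eq0 z x : `|z| < r%:C -> x = z *: L x -> x = 0.
Proof.
move=> zr xE; apply/eqP; rewrite -normr_eq0 -[_ == 0]negbK; apply/negP => x0.
have xgt : 0 < `|x| by rewrite lt0r x0 normr_ge0.
have := scale_half x zr; rewrite -xE ler_pMl// => /le_lt_trans.
by move=> /(_ 1); rewrite ltxx invf_lt1// ltr1n => /(_ isT).
Qed.

Lemma resolventE z h : `|z| < r%:C -> resolvent z h = h + z *: L (resolvent z h).
Proof.
move=> zr; have [zL zLE] : exists zL : {linear X -> X}, forall x, zL x = z *: L x.
  by apply: linear_pack => a x y; rewrite linearP scalerDr !scalerA mulrC.
have [x|y yE] := @half_contraction_solve zL _ h; first by rewrite zLE scale_half.
by apply: (@xgetPex _ 0 [set y | y = h + z *: L y]); exists y; rewrite /= -zLE.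
Qed.

Lemma resolvent_uniq z h y : `|z| < r%:C -> y = h + z *: L y -> y = resolvent z h.
Proof.
move=> zr yE; apply/eqP; rewrite -subr_eq0; apply/eqP.
apply: (half_contraction_eq0 zr).
by rewrite linearB scalerBr {1}yE {1}(resolventE h zr) opprD addrACA subrr add0r.
Qed.

Lemma resolvent_linear z : `|z| < r%:C -> linear (resolvent z).
Proof.
move=> zr a h k; apply/esym/(resolvent_uniq zr).
rewrite linearP scalerDr scalerA [z * a]mulrC -scalerA addrACA -scalerDr.
by rewrite -!resolventE.
Qed.

Lemma resolvent_norm z h : `|z| < r%:C -> `|resolvent z h| <= 2 * `|h|.
Proof.
move=> zr; set y := resolvent z h.
have : `|y| <= `|h| + 2^-1 * `|y|.
  by rewrite {1}/y resolventE// (le_trans (ler_normD _ _))// lerD2l scale_half.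
rewrite -lerBlDr -{1}[ `|y| ]mul1r -mulrBl.
by rewrite (_ : 1 - 2^-1 = 2^-1) 1?mulrC ?ler_pdivrMr// 1?mulrC//; field.
Qed.

Lemma resolvent_identity z w h : `|z| < r%:C -> `|w| < r%:C ->
  resolvent w h - resolvent z h = (w - z) *: resolvent w (L (resolvent z h)).
Proof.
move=> zr wr; set y := resolvent w h; set x := resolvent z h.
pose lw : {linear X -> X} := HB.pack_for {linear X -> X} (resolvent w)
  (GRing.isLinear.Build _ _ _ _ (resolvent w) (resolvent_linear wr)).
rewrite -[RHS]/((w - z) *: lw (L x)) -linearZ; apply: (resolvent_uniq wr).
rewrite linearB scalerBr [in LHS]/y resolventE// -/y [in LHS]/x resolventE// -/x.
rewrite opprD addrACA subrr add0r scalerBl.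
by rewrite [RHS]addrC addrA subrK.
Qed.

Lemma resolvent_left_inverse (T : {linear X -> X}) z g :
  cancel T L -> `|z| < r%:C -> resolvent z (T g) = T g + z *: resolvent z g.
Proof.
move=> TK zr; apply/esym/(resolvent_uniq zr).
by rewrite linearD linearZ/= TK -resolventE.
Qed.

End Resolvent.

(** * Models by multiplication by the coordinate *)

Section HolomorphicModel.
Variables (R : realType) (X : completeNormedModType R[i]).
Variables (W : normedModType R[i]).
Local Notation Re := (@complex.Re R).

(** T acts as multiplication by z in a faithful representation of X by holomorphic
functions on a disc.  The space itself is the carrier, so that no transport along
an isomorphism is needed. *)
Definition coordinate_model (T : X -> X) :=
  exists r (phi : {linear X -> (R[i]^o -> W)}),
    [/\ 0 < r,
        forall h, (forall z, disc 0 r z -> phi h z = 0) -> h = 0,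
        forall h, holomorphic_on (disc 0 r) (phi h) &
        forall h z, disc 0 r z -> phi (T h) z = z *: phi h z].

(** The function attached to h is A (1 - z L)^-1 h.  Here 1 - z L sends
T g + z (1 - z L)^-1 g to T g, so A T = 0 gives the multiplication rule. *)
Lemma holomorphic_model (T L : {linear X -> X}) (A : {linear X -> W}) (C C' : R) :
  (forall x, `|L x| <= C%:C * `|x|) -> (forall x, `|A x| <= C'%:C * `|x|) ->
  cancel T L -> (forall x, A (T x) = 0) -> (forall x, A x = 0 -> T (L x) = x) ->
  (forall x, (forall n, exists y, x = iter n T y) -> x = 0) ->
  coordinate_model T.
Proof.
wlog C0 : C / 0 < C.
  move=> wl LC; apply: (wl (`|C| + 1)); first by rewrite ltr_wpDl.
  move=> x; rewrite (le_trans (LC x))// ler_wpM2r// lecR.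
  by rewrite (le_trans (ler_norm C))// lerDl.
wlog C'0 : C' / 0 < C'.
  move=> wl LC AC; apply: (wl (`|C'| + 1)) => [|//|x]; first by rewrite ltr_wpDl.
  rewrite (le_trans (AC x))// ler_wpM2r// lecR.
  by rewrite (le_trans (ler_norm C'))// lerDl.
move=> LC AC TK AT kerA rangeT.
pose r := (2 * C)^-1; have r0 : 0 < r by rewrite invr_gt0 mulr_gt0.
have disc0 : disc 0 r (0 : R[i]) by rewrite disc0E normr0 ltcR.
pose res := resolvent L.
pose F h z : W := if `|z| < r%:C then A (res z h) else 0.
have FE h z : disc 0 r z -> F h z = A (res z h).
  by rewrite disc0E /F => ->.
have [phi phiF] : exists phi : {linear X -> (R[i]^o -> W)}, forall h, phi h = F h.
  apply: linear_pack => a h k; apply/funext => z.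
  suff : F (a *: h + k) z = a *: F h z + F k z by [].
  rewrite /F; case: ifPn => [zr|_]; last first.
    by rewrite scaler0 addr0.
  by rewrite /res (resolvent_linear C0 LC zr) linearP.
have phiE h z : disc 0 r z -> phi h z = A (res z h) by rewrite phiF; exact: FE.
have res_le h z : disc 0 r z -> `|A (res z h)| <= (C' * 2)%:C * `|h|.
  rewrite disc0E => zr; rewrite (le_trans (AC _))// rmorphM/= -mulrA.
  by rewrite ler_wpM2l ?ler0c ?(ltW C'0)// (le_trans (resolvent_norm C0 LC h zr))// rmorph_nat.
have phiT h z : disc 0 r z -> phi (T h) z = z *: phi h z.
  move=> zr; rewrite !phiE//; rewrite disc0E in zr.
  by rewrite /res (resolvent_left_inverse C0 LC h TK zr) linearD AT add0r linearZ.
have diffE h z w : disc 0 r z -> disc 0 r w ->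
    phi h w - phi h z = (w - z) *: A (res w (L (res z h))).
  move=> zr wr; rewrite !phiE// -linearB /res.
  rewrite !disc0E in zr wr.
  by rewrite (resolvent_identity C0 LC h zr wr) linearZ.
(* resolvents are bounded by 2, uniformly in the disc *)
have lip h z : disc 0 r z -> exists2 K : R, 0 < K &
    forall w, disc 0 r w -> `|phi h w - phi h z| <= `|w - z| * K%:C.
  move=> zr; exists (C' * 2 * Re `|L (res z h)| + 1).
    by rewrite ltr_wpDl// !mulr_ge0 ?(ltW C'0)// -ler0c ReK_ge0.
  move=> w wr; rewrite diffE// normrZ ler_wpM2l// (le_trans (res_le _ _ wr))//.
  by rewrite rmorphD [X in _ <= X + _]rmorphM/= ReK_ge0// lerDl ler01.
(* the derivative is A (1 - z L)^-1 L (1 - z L)^-1 h *)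
have holo h : holomorphic_on (disc 0 r) (phi h).
  move=> z zr; pose g := L (res z h); have [K K0 gK] := lip g z zr.
  rewrite /derivable; apply/cvg_ex; exists (A (res z g)).
  apply/cvgrPdist_lt => eps eps0.
  have d0 : 0 < eps / K%:C by rewrite divr_gt0// ltcR.
  have dz : 0 < r%:C - `|z| by rewrite subr_gt0 -disc0E.
  near=> t.
  have t0 : t != 0 by near: t; exact: nbhs_dnbhs_neq.
  have tz : disc 0 r (t + z).
    rewrite disc0E (le_lt_trans (ler_normD _ _))// -ltrBrDr.
    by near: t; exact: dnbhs0_lt.
  rewrite /= -[t *: 1]/(t * 1) mulr1 diffE// addrK scalerA mulVf// scale1r -/g.
  rewrite -!phiE// distrC (le_lt_trans (gK _ tz))// addrK -ltr_pdivlMr ?ltcR//.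
  by near: t; exact: dnbhs0_lt.
(* If the function of h vanishes, so does that of L h: its value at 0 is A h, so
   h = T (L h), and z times the function of L h vanishes.  Dividing by z leaves
   the point 0, which continuity settles. *)
have phi_shift h : (forall z, disc 0 r z -> phi h z = 0) ->
    T (L h) = h /\ forall z, disc 0 r z -> phi (L h) z = 0.
  move=> h0; have Th : T (L h) = h.
    apply: kerA; rewrite -(h0 _ disc0) phiE// /res (resolventE C0 LC) -?disc0E//.
    by rewrite scale0r addr0.
  split=> // z zr; have z0P w : disc 0 r w -> w != 0 -> phi (L h) w = 0.
    move=> wr w0; have := h0 w wr; rewrite -{1}Th phiT// => /eqP.
    by rewrite scaler_eq0 (negPf w0) => /eqP.
  have [->|] := eqVneq z 0; last exact: z0P.
  have [K K0 hK] := lip (L h) 0 disc0.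
  apply/eqP; rewrite -normr_eq0; apply/negPn/negP => n0.
  have d0 : 0 < `|phi (L h) 0| / K%:C by rewrite divr_gt0 ?ltcR// lt0r n0 normr_ge0.
  near (0 : R[i]^o)^' => w.
  have wr : disc 0 r w by rewrite disc0E; near: w; apply: dnbhs0_lt; rewrite ltcR.
  have w0 : w != 0 by near: w; exact: nbhs_dnbhs_neq.
  have := hK w wr; rewrite z0P// sub0r normrN subr0; apply/negP.
  rewrite -real_ltNge ?realM ?normr_real ?ger0_real ?ler0c ?(ltW K0)//.
  rewrite -ltr_pdivlMr ?ltcR//.
  by near: w; exact: dnbhs0_lt.
(* iterating phi_shift gives h = T^n L^n h for all n *)
exists r, phi; split=> // h h0; apply: rangeT => n; exists (iter n L h).
elim: n h h0 => // n IHn h /phi_shift[Th /IHn ih].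
by rewrite iterS iterSr -ih Th.
Unshelve. all: by end_near. Qed.

End HolomorphicModel.

(** * The ancestors of the generalized root *)

Lemma card1_eq (T : Type) (A : set T) x y : A #= `I_1 -> A x -> A y -> x = y.
Proof.
rewrite card_eq_le => /andP[/card_leP[f] _] Ax Ay.
have fI (a : A) : val (f a) = 0%N.
  by have := set_valP (f a); rewrite /= ltnS leqn0 => /eqP.
have /(congr1 val) : SigSub (mem_set Ax) = SigSub (mem_set Ay) :> A.
  by apply: (@inj _ _ _ f); rewrite ?in_setT//; apply/val_inj; rewrite !fI.
by [].
Qed.

Section Spine.
Variables (V : countType) (e : rel V) (omega : V).
Hypotheses (tree_e : directed_tree e) (rootless_e : rootless e).
Hypothesis gen_omega : generalized_root e omega.

(** The spine starts at the parent of omega: omega itself belongs to the branching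
part. *)
Definition spine k : V := iter k.+1 (par e) omega.

Lemma par_edge v : e (par e v) v.
Proof.
case: tree_e => _ _ _ /(_ v (@rootless_e v))[u [uv _]].
by apply: (@xgetPex _ v [set u | e u v]); exists u.
Qed.

Lemma edge_par u v : e u v -> par e v = u.
Proof.
case: tree_e => _ _ _ /(_ v (@rootless_e v))[w [_ uniq_w]] uv.
by rewrite -(uniq_w _ uv) (uniq_w _ (par_edge v)).
Qed.

Lemma only_child k v : par e v = spine k -> v = iter k (par e) omega.
Proof.
case: gen_omega => _ /(_ k.+1 isT) card1 pv.
have child u : par e u = spine k -> Chi e [set spine k] u.
  by move=> pu; exists (spine k) => //=; rewrite -pu par_edge.
exact: (card1_eq card1 (child _ pv) (child _ _)).
Qed.

Lemma omega_off_spine k : spine k <> omega.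
Proof.
case: gen_omega => branch /(_ k.+1 isT) card1 spk; rewrite -/(spine k) spk in card1.
by move: branch; rewrite /branching_vertices/= (card_le_eqr card1) card_le_II.
Qed.

(** Ancestors of the same vertex could coincide only by descending, through unique
children, to an ancestor of omega equal to omega, which has several children. *)
Lemma spine_inj : injective spine.
Proof.
elim=> [|i IHi] [|j]//.
- by move=> /esym /only_child /omega_off_spine.
- by move=> /only_child /omega_off_spine.
- by move=> /only_child /IHi ->.
Qed.

(** Having a common ancestor with omega is preserved along edges in both directions,
so connectedness spreads it to all vertices. *)
Lemma ancestor_on_spine v : exists n m, iter n (par e) v = iter m (par e) omega.
Proof.
have [->|vo] := eqVneq v omega; first by exists 0%N, 0%N.
have [p + <-] : exists2 p : seq V,
    path [rel a b | e a b || e b a] omega p & last omega p = v.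
  by case: tree_e => _ + _ _; apply; rewrite eq_sym.
have : exists n m, iter n (par e) omega = iter m (par e) omega by exists 0%N, 0%N.
elim: p {1 3 4}omega => //= b p IHp a [n [m nm]] /andP[ab].
apply: IHp; case/orP: ab => [/edge_par|] ab.
  by exists n.+1, m; rewrite iterSr ab.
case: n nm => [|n] nm; last by exists n, m; rewrite -(edge_par ab) -iterSr.
by exists 0%N, m.+1; rewrite iterS -nm /= (edge_par ab).
Qed.

(** From a common ancestor omega_m, both lines of descent go through the only
children of omega_m, ..., omega_1 as long as they have not reached v. *)
Lemma off_spine_descends v : (forall k, v <> spine k) ->
  exists n, iter n (par e) v = omega.
Proof.
move=> voff; have [n [m]] := ancestor_on_spine v.
elim: m n => [|m IHm] n; first by exists n.
by case: n => [/voff//|n] /only_child/IHm.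
Qed.

End Spine.
(** * Splitting l2 along an injection *)

Section Compressions.
Variable R : realType.
Implicit Types V : choiceType.

Lemma l2_restriction V V' (i : V' -> V) : injective i ->
  exists P : {linear l2 R V -> l2 R V'}, bounded_operator P /\
    forall f a, P f a = f (i a).
Proof.
move=> i_inj.
have [|a|P [bP PE]] := @l2_weighted_comp R V V' (fun a => Some (i a)) (fun=> 1) 1.
- by move=> a b v [<-] [/i_inj].
- by rewrite normr1.
by exists P; split=> // f a; rewrite PE mul1r.
Qed.

Lemma l2_extension V V' (i : V' -> V) : injective i ->
  exists J : {linear l2 R V' -> l2 R V}, [/\ bounded_operator J,
    forall f a, J f (i a) = f a & forall f v, ~ range i v -> J f v = 0].
Proof.
move=> i_inj; pose sigma v : option V' :=
  if pselect (exists a, i a = v) is left ia then Some (sval (cid ia)) else None.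
have sigmaP v a : sigma v = Some a -> i a = v.
  by rewrite /sigma; case: pselect => // ia [<-]; case: cid.
have sigmaE a : sigma (i a) = Some a.
  rewrite /sigma; case: pselect => [ia|[]]; last by exists a.
  by case: cid => b /= /i_inj ->.
have [|v|J [bJ JE]] := @l2_weighted_comp R V' V sigma (fun=> 1) 1.
- by move=> v w a /sigmaP <- /sigmaP <-.
- by rewrite normr1.
exists J; split=> // f v; first by rewrite JE sigmaE mul1r.
move=> iv; rewrite JE; case sv : (sigma v) => [a|]; last by rewrite mulr0.
by case: iv; exists a => //; exact: sigmaP.
Qed.

Lemma bounded_comp (G H K : preHilbertType R) (T : {linear H -> K}) (T' : {linear G -> H}) :
  bounded_operator T -> bounded_operator T' ->
  exists2 T'' : {linear G -> K}, bounded_operator T'' & forall x, T'' x = T (T' x).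
Proof.
move=> /bounded_ge0[C C0 TC] [C' TC'].
have [T'' TE] : exists T'' : {linear G -> K}, forall x, T'' x = T (T' x).
  by apply: linear_pack => a x y; rewrite !linearP.
exists T'' => //; exists (C * C') => x; rewrite TE (le_trans (TC _))//.
by rewrite rmorphM/= -mulrA ler_wpM2l ?ler0c.
Qed.

Definition off_range V V' (i : V' -> V) : pred V := fun v => ~~ `[< range i v >].

Lemma off_rangeP V V' (i : V' -> V) v : reflect (~ range i v) (off_range i v).
Proof. by apply: (iffP idP) => [/asboolPn|/asboolPn]. Qed.

Lemma l2_norm_split V V' (i : V' -> V) (f : l2 R V)
    (a : l2 R {v : V | off_range i v}) (b : l2 R V') : injective i ->
  (forall d, a d = f (val d)) -> (forall k, b k = f (i k)) ->
  `|f| ^+ 2 = `|a| ^+ 2 + `|b| ^+ 2.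
Proof.
move=> i_inj aE bE; rewrite !l2_normE -rmorphD; congr (_%:C).
rewrite -fineD ?l2_esum_fin//; congr fine.
rewrite (esumID (range i)) ?setTI; last first.
  by move=> v _; rewrite lee_fin Re_normsq_ge0.
rewrite addeC; congr (_ + _)%E.
  rewrite (_ : ~` range i = val @` [set: {v : V | off_range i v}]).
    rewrite esum_image; last by move=> x y _ _; exact: val_inj.
    by apply: eq_esum => d _; rewrite aE.
  apply/seteqP; split=> [v /off_rangeP vi|_ [d _ <-]]; last exact/off_rangeP/(valP d).
  by exists (Sub v vi).
rewrite esum_image; last by move=> x y _ _; exact: i_inj.
by apply: eq_esum => k _; rewrite bE.
Qed.

Lemma l2_split_unitary V V' (i : V' -> V)
    (P : {linear l2 R V -> l2 R {v : V | off_range i v}})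
    (Q : {linear l2 R V -> l2 R V'}) : injective i ->
  (forall f d, P f d = f (val d)) -> (forall f k, Q f k = f (i k)) ->
  exists2 U : {linear l2 R V -> hsum (l2 R {v : V | off_range i v}) (l2 R V')},
    unitary U & forall f, U f = (P f, Q f).
Proof.
move=> i_inj PE QE.
have [U UE] : exists U : {linear l2 R V -> hsum (l2 R {v : V | off_range i v}) (l2 R V')},
    forall f, U f = (P f, Q f).
  by apply: linear_pack => a f g; rewrite !linearP.
exists U => //; split=> [[a b]|]; last first.
  apply: isometry_inner => f; apply/eqP; rewrite -(@eqrXn2 _ 2)//.
  rewrite -[X in X == _]inner_norm inner_hsumE UE !inner_norm/=.
  by rewrite (l2_norm_split i_inj (PE f) (QE f)).
have [J [_ JE J0]] := l2_extension (@val_inj _ _ {v : V | off_range i v}).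
have [J' [_ JE' J0']] := l2_extension i_inj.
exists (J a + J' b); rewrite UE; congr (_, _); apply: l2_ext => x.
  rewrite PE -[LHS]/(J a (val x) + J' b (val x)) JE J0' ?addr0//.
  exact/off_rangeP/(valP x).
rewrite QE -[LHS]/(J a (i x) + J' b (i x)) JE' J0 ?add0r//.
by case=> d _ di; have /off_rangeP := valP d; apply; exists x.
Qed.

End Compressions.

(** * Adjoints of weighted backward shifts *)

Section BackwardShift.
Variables (R : realType) (mu : nat -> R) (c : R).
Variable B : {linear l2 R nat -> l2 R nat}.
Hypotheses (c0 : 0 < c) (mu_ge : forall k, c <= mu k) (bB : bounded_operator B).
Hypothesis BE : forall h k, B h k = (mu k)%:C * h k.+1.

(** The adjoint F of B is the forward shift with the same weights; its model sends
h to the power series with coefficients h n / (mu 0 * ... * mu n.-1), which are the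
values at 0 of the iterates of the left inverse L. *)
Lemma backward_shift_model : exists F : {linear l2 R nat -> l2 R nat},
  [/\ bounded_operator F, is_adjoint F B & coordinate_model R[i]^o F].
Proof.
have mu0 k : 0 < mu k by exact: lt_le_trans c0 (mu_ge k).
have [F [bF adjB]] := l2_adjoint bB; have adjF := is_adjoint_sym adjB.
exists F; split=> //.
have Fcoord h k : F h k = inner h (B (l2_delta k)) by rewrite -inner_delta adjF.
have F0 h : F h 0%N = 0.
  rewrite Fcoord (_ : B _ = 0) ?linear0r//; apply: l2_ext => j.
  by rewrite BE l2_deltaE mulr0.
have FS h k : F h k.+1 = (mu k)%:C * h k.
  rewrite Fcoord (_ : B _ = (mu k)%:C *: l2_delta k); last first.
    apply: l2_ext => j; rewrite BE -[RHS]/((mu k)%:C * l2_delta k j) !l2_deltaE eqSS.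
    by case: eqP => [->//|_]; rewrite !mulr0.
  rewrite (_ : inner h _ = ((mu k)%:C)^* * inner h (l2_delta k)).
    by rewrite inner_delta conj_Creal// ger0_real// ler0c ltW.
  exact: linearZr_LR.
have [|k|L [bL LE]] := @l2_weighted_comp R nat nat (fun k => Some k.+1)
    (fun k => ((mu k)^-1)%:C) c^-1.
- by move=> a b k [<-] [].
- by rewrite ger0_norm ?ler0c ?invr_ge0 ?(ltW (mu0 _))// lecR lef_pV2// posrE.
have [ev evE] : exists ev : {linear l2 R nat -> R[i]^o}, forall h, ev h = h 0%N.
  exact: linear_pack.
have [C LC] := bL.
apply: (@holomorphic_model _ _ _ F L ev C 1) => //.
- by move=> h; rewrite evE mul1r l2_coord_le.
- move=> h; apply: l2_ext => k; rewrite LE FS.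
  by rewrite mulrA -rmorphM/= mulVf ?mul1r// gt_eqF.
- by move=> h; rewrite evE F0.
- move=> h; rewrite evE => h0; apply: l2_ext => -[|k]; first by rewrite F0.
  by rewrite FS LE mulrA -rmorphM/= mulfV ?mul1r// gt_eqF.
- move=> h hF; apply: l2_ext => k; have [g ->] := hF k.+1.
  elim: k => [|k IHk]; first exact: F0.
  by rewrite iterS FS IHk mulr0.
Qed.

End BackwardShift.

(** * The weighted shift off the spine *)

Section TreeShift.
Variables (R : realType) (V : countType) (e : rel V).
Variables (lambda : V -> R) (omega : V) (S : {linear l2 R V -> l2 R V}).
Hypotheses (tree_e : directed_tree e) (rootless_e : rootless e).
Hypothesis gen_omega : generalized_root e omega.
Hypothesis lambda_gt0 : forall v, 0 < lambda v.
Hypothesis shiftS : weighted_shift e lambda S.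

Local Notation s := (spine e omega).
Local Notation D := {v : V | off_range s v}.

Lemma off_spine_neq (d : D) k : val d <> s k.
Proof. by move=> dk; have /off_rangeP := valP d; apply; exists k. Qed.

Lemma omega_offP : off_range s omega.
Proof. by apply/off_rangeP => -[k _]; exact: omega_off_spine. Qed.

Definition omegaD : D := Sub omega omega_offP.

Lemma par_off (d : D) : d != omegaD -> off_range s (par e (val d)).
Proof.
move=> d_omega; apply/off_rangeP => -[k _ /esym pd].
have := only_child tree_e rootless_e gen_omega pd; case: k {pd} => [dE|k /off_spine_neq//].
by case/eqP: d_omega; apply: val_inj.
Qed.

Lemma shift_delta_spine k : S (l2_delta (s k.+1)) = (lambda (s k))%:C *: l2_delta (s k).
Proof.
apply: l2_ext => v; rewrite shiftS -[RHS]/((lambda (s k))%:C * l2_delta (s k) v).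
rewrite !l2_deltaE.
have [->|vs] := eqVneq v (s k); first by rewrite eqxx.
rewrite (_ : _ == _ = false) ?mulr0//; apply/negP => /eqP.
by move/(only_child tree_e rootless_e gen_omega)/eqP; apply/negP.
Qed.

(** The weight at omega_k is the norm of the image of a basis vector, and a left
inverse cannot expand it by more than its bound. *)
Lemma left_invertible_spine : left_invertible S ->
  exists2 c : R, 0 < c & forall k, c <= lambda (s k).
Proof.
case=> L /bounded_ge0[C C0 LC] SK.
have C1 k : 1 <= C * lambda (s k).
  have := LC (S (l2_delta (s k.+1))); rewrite SK l2_delta_norm shift_delta_spine.
  rewrite normrZ l2_delta_norm mulr1 ger0_norm ?ler0c ?(ltW (lambda_gt0 _))//.
  by rewrite -rmorphM lecR.
have Cgt0 : 0 < C.
  rewrite lt_neqAle C0 andbT; apply/eqP => C0'.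
  by have := C1 0%N; rewrite -C0' mul0r ler10.
by exists C^-1; rewrite ?invr_gt0// => k; rewrite -[leLHS]mulr1 ler_pdivrMl.
Qed.

Variable T : {linear l2 R D -> l2 R D}.
Hypothesis TE : forall a d,
  T a d = (lambda (val d))%:C * (if insub (par e (val d)) is Some d' then a d' : R[i] else 0).

Lemma compression_omega a : T a omegaD = 0.
Proof.
rewrite TE insubN ?mulr0//; apply/negP => /off_rangeP; apply.
by exists 0%N.
Qed.

(** T reads the value at the parent, and the line of parents ends at omega, where T a
vanishes. *)
Lemma iter_compression_eq0 n a d : iter n (par e) (val d) = omega -> iter n.+1 T a d = 0.
Proof.
elim: n d => [|n IHn] d.
  by move=> dE; rewrite (_ : d = omegaD) ?compression_omega//; apply: val_inj.
have [->|/par_off pd] := eqVneq d omegaD; first by rewrite [iter _ _ _]iterS compression_omega.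
rewrite iterSr => dE; rewrite iterS TE (insubT _ pd) IHn ?mulr0//.
Qed.

Lemma compression_analytic a : (forall n, exists b, a = iter n T b) -> a = 0.
Proof.
move=> aT; apply: l2_ext => d.
have [n dn] := off_spine_descends tree_e rootless_e gen_omega (@off_spine_neq d).
by have [b ->] := aT n.+1; exact: iter_compression_eq0.
Qed.

End TreeShift.

Theorem theorem6p6 (R : realType) (V : countType) (e : rel V)
    (lambda : V -> R) (omega : V) (S : {linear l2 R V -> l2 R V}) :
  infinite_set [set: V] ->
  directed_tree e ->
  leafless e ->
  rootless e ->
  finite_branching_index e ->
  branching_vertices e !=set0 ->
  generalized_root e omega ->
  (forall v, 0 < lambda v) ->
  weighted_shift e lambda S ->
  bounded_operator S ->
  left_invertible S ->
  exists (E : hilbertType R) (c1 c2 : R[i]) (r1 r2 : R)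
    (X : holoSpace E (disc c1 r1)) (Y : holoSpace R[i]^o (disc c2 r2))
    (Mz Mzstar : {linear X -> X}) (Mt Mtstar : {linear Y -> Y})
    (f : X) (g : Y),
    [/\ 0 < r1 /\ 0 < r2,
        [/\ bounded_operator Mz, multiplication_by_coordinate Mz &
            is_adjoint Mz Mzstar],
        [/\ bounded_operator Mt, multiplication_by_coordinate Mt &
            is_adjoint Mt Mtstar],
        (f != 0 /\ Mzstar f = 0) /\ (g != 0 /\ Mtstar g = 0) &
        unitarily_equivalent S (upper_triangular Mz (rank_one f g) Mtstar)].
Proof.
move=> _ tree_e _ rootless_e _ _ gen_omega lambda_gt0 shiftS bS invS.
have s_inj := spine_inj tree_e rootless_e gen_omega.
have [c c0 lambda_ge] :=
  left_invertible_spine tree_e rootless_e gen_omega lambda_gt0 shiftS invS.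
set s := spine e omega in s_inj lambda_ge.
pose D : choiceType := {v : V | off_range s v}.
pose d0 : D := omegaD gen_omega.
have val_inj' : injective (fun d : D => val d) by exact: val_inj.
have [P [bP PE]] := l2_restriction R val_inj'.
have [J [bJ JE J0]] := l2_extension R val_inj'.
have [Q [bQ QE]] := l2_restriction R s_inj.
have [J' [bJ' JE' J0']] := l2_extension R s_inj.
have JsE a k : J a (s k) = 0.
  by apply: J0 => -[d _ ds]; have /off_rangeP := valP d; apply; exists k.
have [SJ bSJ SJE] := bounded_comp bS bJ.
have [T bT TE] := bounded_comp bP bSJ.
have TcE a d : T a d = (lambda (val d))%:C * J a (par e (val d)).
  by rewrite TE PE SJE shiftS.
(* l2(D) is invariant under S, so L compressed to l2(D) is a left inverse of T *)
have JT a : J (T a) = S (J a).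
  apply: l2_ext => v; have [vD|] := boolP (off_range s v).
    by rewrite -[v]/(val (Sub v vD : D)) JE TE PE SJE.
  rewrite /off_range negbK => /asboolP[k _ <-].
  by rewrite JsE shiftS -[par e (s k)]/(s k.+1) JsE mulr0.
have [L bL SK] := invS.
have [LJ bLJ LJE] := bounded_comp bL bJ.
have [LD bLD LDE] := bounded_comp bP bLJ.
have TK : cancel T LD.
  by move=> a; apply: l2_ext => d; rewrite LDE LJE JT SK PE JE.
have T_off a d : T a d = (lambda (val d))%:C *
    (if insub (par e (val d)) is Some d' then a d' : R[i] else 0).
  rewrite TcE; case: insubP => [d' _ <-|/negP pd]; first by rewrite JE.
  rewrite J0// => -[d' _ d'E]; apply: pd; rewrite -d'E; exact: valP.
have T_ana := compression_analytic tree_e rootless_e gen_omega T_off.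
(* the projection 1 - T LD has the range of T as its kernel *)
have [rX [phiX [rX0 injX holoX multX]]] : coordinate_model (l2 R D) T.
  have [A AE] : exists A : {linear l2 R D -> l2 R D}, forall a, A a = a - T (LD a).
    by apply: linear_pack => z a b; rewrite !linearP scalerDr addrACA.
  have [C LC] := bLD; have [C' C'0 TC'] := bounded_ge0 bT.
  apply: (@holomorphic_model _ _ _ T LD A C (1 + C' * C)) => // a.
  - rewrite AE rmorphD rmorphM/= mulrDl mul1r (le_trans (ler_normB _ _))// lerD2l.
    by rewrite (le_trans (TC' _))// -mulrA ler_wpM2l ?ler0c.
  - by rewrite AE TK subrr.
  - by rewrite AE => /eqP; rewrite subr_eq0 => /eqP.
have [SJ' bSJ' SJE'] := bounded_comp bS bJ'.
have [B bB BE] := bounded_comp bQ bSJ'.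
have BsE h k : B h k = (lambda (s k))%:C * h k.+1.
  by rewrite BE QE SJE' shiftS -[par e (s k)]/(s k.+1) JE'.
have [F [bF adjF [rY [phiY [rY0 injY holoY multY]]]]] :=
  backward_shift_model c0 lambda_ge bB BsE.
have [Tstar [bTstar adjT]] := l2_adjoint bT.
have T0 a : T a d0 = 0 by exact: (compression_omega gen_omega T_off).
pose f : l2 R D := (lambda omega)%:C *: l2_delta d0.
have f0 : f != 0.
  rewrite scaler_eq0 negb_or -(normr_eq0 (l2_delta d0)) l2_delta_norm oner_eq0.
  by rewrite andbT gt_eqF// ltcR.
(* |Tstar f|^2 is the inner product of T (Tstar f) with f, and T a vanishes at omega *)
have Tstar_f : Tstar f = 0.
  apply/eqP; rewrite -normr_eq0 -sqrf_eq0 -inner_norm -adjT.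
  rewrite (_ : inner _ f = ((lambda omega)%:C)^* * inner (T (Tstar f)) (l2_delta d0)).
    by rewrite inner_delta T0 mulr0.
  exact: linearZr_LR.
pose g : l2 R nat := l2_delta 0%N.
have g0 : g != 0 by rewrite -normr_eq0 l2_delta_norm oner_eq0.
have B_g : B g = 0 by apply: l2_ext => k; rewrite BsE l2_deltaE mulr0.
have [U unitU UE] := l2_split_unitary s_inj PE QE.
have US x : U (S x) = upper_triangular T (rank_one f g) B (U x).
  rewrite !UE; congr (_, _); last first.
    by apply: l2_ext => k; rewrite QE BsE shiftS QE.
  apply: l2_ext => d; rewrite PE shiftS /rank_one inner_delta QE.
  rewrite -[RHS]/(T (P x) d + x (s 0%N) * ((lambda omega)%:C * l2_delta d0 d)) l2_deltaE.
  have [->|d_omega] := eqVneq d d0; first by rewrite T0 add0r mulr1 mulrC.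
  rewrite !mulr0 addr0 TcE; congr (_ * _).
  have pd := par_off tree_e rootless_e d_omega.
  by rewrite -[par e _]/(val (Sub _ pd : D)) JE PE.
exists (l2 R D), 0, 0, rX, rY, (HoloSpace injX holoX), (HoloSpace injY holoY).
exists T, Tstar, F, B, f, g; split=> //.
by exists U.
Qed.
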